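(* Let $d\ge 1$ and let $\mathcal{S}\subset\{-1,0,1\}^d\setminus\{\mathbf{0}\}$ be a weighted step set that is symmetric over each of the first $d-1$ coordinate axes, that contains, for each $1\le j\le d$, a step with $j$th coordinate $+1$ and a step with $j$th coordinate $-1$, and that has zero drift, i.e. $A(\mathbf{1})=B(\mathbf{1})$. Let $s_n$ be the total weight of walks of length $n$ taking steps in $\mathcal{S}$, starting at the origin, and never leaving $\mathbb{N}^d$. Then, as $n\to\infty$, \[ s_n \sim S(\mathbf{1})^n \cdot n^{-d/2}\cdot \frac{S(\mathbf{1})^{d/2}}{\pi^{d/2}(b_1\cdots b_d)^{1/2}}. \]
   Context: Each step $\mathbf{i}\in\mathcal{S}$ carries a positive real weight $w_{\mathbf{i}}$; the weight of a walk is the product of the weights of its steps. The characteristic polynomial is the Laurent polynomial $S(\mathbf{z})=\sum_{\mathbf{i}\in\mathcal{S}} w_{\mathbf{i}} z_1^{i_1}\cdots z_d^{i_d}$. $\mathcal{S}$ is symmetric over the $k$th coordinate axis if $\mathcal{S}$ is invariant under negating the $k$th coordinate and each step has the same weight as its reflection. Writing $\hat{\mathbf{z}}=(z_1,\dots,z_{d-1})$, symmetry over the first $d-1$ axes means $S(\mathbf{z})=z_d^{-1}A(\hat{\mathbf{z}})+Q(\hat{\mathbf{z}})+z_dB(\hat{\mathbf{z}})$ for Laurent polynomials $A,Q,B$ invariant under $z_j\mapsto 1/z_j$ for each $j\le d-1$. $\mathbf{1}=(1,\dots,1)$. For $1\le k\le d$, $b_k=\sum_{\mathbf{i}\in\mathcal{S},\,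 i_k=1} w_{\mathbf{i}}$ is the total weight of steps moving forward in coordinate $k$. *)

(* Defs.v *)
From HB Require Import structures.
From mathcomp Require Import all_boot all_order all_algebra.
From mathcomp Require Import all_classical all_reals all_analysis.
Set Implicit Arguments. Unset Strict Implicit. Unset Printing Implicit Defensive.
Import Order.TTheory GRing.Theory Num.Theory.
Local Open Scope ring_scope.

(* A step in {-1,0,1}^d: each coordinate is an element c of 'I_3,
   representing the integer c - 1. *)
Definition step (d : nat) := {ffun 'I_d -> 'I_3}.

Definition stepc (d : nat) (s : step d) (k : 'I_d) : int := (s k)%:Z - 1.

Definition zero_step (d : nat) : step d := [ffun _ => inord 1].

Definition reflect_step (d : nat) (k : 'I_d) (s : step d) : step d :=
  [ffun i => if i == k then rev_ord (s i) else s i].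

Definition symmetric_axis (R : realType) (d : nat) (S : {set step d})
    (w : step d -> R) (k : 'I_d) : Prop :=
  forall s, s \in S -> reflect_step k s \in S /\ w (reflect_step k s) = w s.

Definition total_weight (R : realType) (d : nat) (S : {set step d})
    (w : step d -> R) : R := \sum_(s in S) w s.

Definition coord_weight (R : realType) (d : nat) (S : {set step d})
    (w : step d -> R) (k : 'I_d) (c : int) : R :=
  \sum_(s in S | stepc s k == c) w s.

Definition quadrant_walk (d n : nat) (S : {set step d})
    (f : {ffun 'I_n -> step d}) : bool :=
  [forall i, f i \in S] &&
  [forall m : 'I_n.+1, [forall j : 'I_d,
     (0 <= \sum_(i < n | (i < m)%N) stepc (f i) j)%R]].

Definition num_walks (R : realType) (d : nat) (S : {set step d})
    (w : step d -> R) (n : nat) : R :=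
  \sum_(f : {ffun 'I_n -> step d} | quadrant_walk S f) \prod_(i < n) w (f i).

(* Main.v *)
Require Import Defs.
From HB Require Import structures.
From mathcomp Require Import all_boot all_order all_algebra.
From mathcomp Require Import all_classical all_reals all_analysis.
From mathcomp Require Import ring lra zify.
Import Order.TTheory GRing.Theory Num.Theory.
Import numFieldNormedType.Exports.
Local Open Scope classical_set_scope.
Local Open Scope ring_scope.

(** Normalise the weights to probabilities.  Since the step set is symmetric over
    an axis, the signs of the moves along that axis are independent fair coins
    once one conditions on which steps move and on all other coordinates.  Hence
    "coordinate [k] stays nonnegative" may be replaced, inside the expectation, by
    the probability ['C(N, (N.+1)./2) / 2 ^+ N] that a simple walk of length [N]
    stays nonnegative, [N] being the number of steps moving in coordinate [k].
    This is done for the first [d - 1] coordinates jointly, and for the last one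
    alone, where zero drift gives a marginal symmetry.  By Wallis' product the
    probability is equivalent to [sqrt (2 / (pi * N))], and by a Chernoff bound
    [N] is concentrated around [n] times the probability of a move, namely
    [2 * b_k / S(1)], so every coordinate contributes a factor
    [sqrt (S(1) / (pi * b_k * n))]. *)

(** * Walks on a half-line *)

(* Heights are shifted by one: height [1] is the origin of the half-line, and a
   walk reaching height [0] has left it. *)
Fixpoint stay_count (m h : nat) : nat :=
  match m, h with
  | _, 0%N => 0%N
  | 0%N, _.+1 => 1%N
  | m'.+1, h'.+1 => (stay_count m' h'.+2 + stay_count m' h')%N
  end.

(** The number of simple walks of length [m] with fewer than [x] up-moves, hence ending below a
    given level. *)
Definition binomial_sum (m x : nat) : nat := (\sum_(j < x) 'C(m, j))%N.

Lemma binomial_sumSS m x :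
  binomial_sum m.+1 x.+1 = (binomial_sum m x.+1 + binomial_sum m x)%N.
Proof.
rewrite /binomial_sum big_ord_recl [in RHS]big_ord_recl !bin0 -addnA.
by rewrite -big_split.
Qed.

Lemma binomial_sum0 m : binomial_sum m 0 = 0%N.
Proof. by rewrite /binomial_sum big_ord0. Qed.

Lemma binomial_sum0n x : (0 < x)%N -> binomial_sum 0 x = 1%N.
Proof.
case: x => // x _; rewrite /binomial_sum big_ord_recl big1 ?addn0//.
Qed.

(* Reflection principle: a walk starting from height [h] survives as often as an
   unconstrained one ends at a height in [1 - h, h] relative to its start. *)
Lemma stay_count_binomial_sum m h :
  (stay_count m h + binomial_sum m ((m + 2 - h) %/ 2) =
   binomial_sum m ((m + h + 2) %/ 2))%N.
Proof.
elim: m h => [|m IH] [|h].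
- by [].
- rewrite [in RHS]binomial_sum0n; last by lia.
  have -> : ((0 + 2 - h.+1) %/ 2 = 0)%N by lia.
  by rewrite binomial_sum0.
- by rewrite /= add0n; congr binomial_sum; rewrite subn0 addn0.
have := IH h.+2; have := IH h.
have -> : stay_count m.+1 h.+1 = (stay_count m h.+2 + stay_count m h)%N by [].
set x := ((m + h + 2) %/ 2)%N; set y := ((m + 2 - h) %/ 2)%N.
have -> : ((m + h.+2 + 2) %/ 2 = x.+1)%N by rewrite /x; lia.
have -> : ((m.+1 + h.+1 + 2) %/ 2 = x.+1)%N by rewrite /x; lia.
have -> : ((m + 2 - h.+2) %/ 2 = y.-1)%N by rewrite /y; lia.
(* [y = 0] means that the start is too high for height [0] to be reached in time; the subtracted sum
   is then empty. *)
rewrite binomial_sumSS; case: y => [|y];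
  rewrite ?binomial_sumSS ?binomial_sum0 /=; lia.
Qed.

(** From height [1] the two partial sums of the reflection principle differ by a single binomial
    coefficient. *)
Lemma stay_count1 m : stay_count m 1 = 'C(m, (m.+1)./2).
Proof.
have := stay_count_binomial_sum m 1; rewrite -divn2.
have -> : ((m + 1 + 2) %/ 2 = ((m + 2 - 1) %/ 2).+1)%N by lia.
have -> : (m.+1 %/ 2 = (m + 2 - 1) %/ 2)%N by lia.
rewrite {2}/binomial_sum big_ord_recr /= -/(binomial_sum _ _); lia.
Qed.

Definition stay_prob (R : realType) (m h : nat) : R :=
  (stay_count m h)%:R / 2 ^+ m.
Arguments stay_prob : clear implicits.

Lemma stay_prob0 (R : realType) m : stay_prob R m 0 = 0.
Proof. by rewrite /stay_prob; case: m => [|m] /=; rewrite mul0r. Qed.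

Lemma stay_probS (R : realType) m h :
  stay_prob R m.+1 h.+1 = (stay_prob R m h.+2 + stay_prob R m h) / 2.
Proof.
by rewrite /stay_prob /= natrD exprS; field; rewrite expf_neq0.
Qed.

Lemma stay_prob_ge0 (R : realType) m h : 0 <= stay_prob R m h.
Proof. by rewrite /stay_prob divr_ge0// exprn_ge0. Qed.

Lemma stay_prob_le1 (R : realType) m h : stay_prob R m h <= 1.
Proof.
elim: m h => [|m IH] [|h]; rewrite ?stay_prob0// ?ler01//.
  by rewrite /stay_prob /= expr0 divr1.
by rewrite stay_probS; have := IH h; have := IH h.+2; lra.
Qed.

(** For probability weights this is the expectation of [F] over [n] independent steps. Recursion on
    the first step makes every induction a conditioning on that step. *)
Fixpoint walk_sum {R : realType} {T : finType} (w : T -> R) (n : nat)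
    (F : seq T -> R) : R :=
  if n is n'.+1 then \sum_t w t * walk_sum w n' (fun s => F (t :: s))
  else F [::].

(* [c t] in [{0, 1, 2}] encodes a move by [c t - 1]; heights are shifted as in
   [stay_count]. *)
Fixpoint stays {T : Type} (c : T -> nat) (h : nat) (s : seq T) : bool :=
  (0 < h)%N && (if s is t :: s' then stays c (h + c t).-1 s' else true).

Definition moves {T : Type} (c : T -> nat) (s : seq T) : nat :=
  count (fun t => c t != 1%N) s.

Lemma eq_walk_sum {R : realType} {T : finType} (w : T -> R) n F G :
  F =1 G -> walk_sum w n F = walk_sum w n G.
Proof.
elim: n F G => [|n IH] F G FG /=; first exact: FG.
by apply: eq_bigr => t _; congr *%R; apply: IH => s; apply: FG.
Qed.

Lemma walk_sumD {R : realType} {T : finType} (w : T -> R) n F G :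
  walk_sum w n (fun s => F s + G s) = walk_sum w n F + walk_sum w n G.
Proof.
elim: n F G => [|n IH] F G //=; rewrite -big_split; apply: eq_bigr => t _.
by rewrite IH mulrDr.
Qed.

Lemma walk_sumZ {R : realType} {T : finType} (w : T -> R) n a F :
  walk_sum w n (fun s => a * F s) = a * walk_sum w n F.
Proof.
elim: n F => [|n IH] F //=; rewrite mulr_sumr; apply: eq_bigr => t _.
by rewrite IH mulrCA.
Qed.

Lemma walk_sum_scale {R : realType} {T : finType} (w : T -> R) n (a : R) F :
  walk_sum (fun t => a * w t) n F = a ^+ n * walk_sum w n F.
Proof.
elim: n F => [|n IH] F; first by rewrite expr0 mul1r.
rewrite /= mulr_sumr; apply: eq_bigr => t _.
by rewrite IH exprS; ring.
Qed.

Lemma walk_sum_sum {R : realType} {T : finType} (w : T -> R) n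
    (I : finType) (F : I -> seq T -> R) :
  walk_sum w n (fun s => \sum_i F i s) = \sum_i walk_sum w n (F i).
Proof.
elim: n F => [|n IH] F //=; rewrite exchange_big; apply: eq_bigr => t _ /=.
by rewrite IH mulr_sumr.
Qed.

Lemma le_walk_sum {R : realType} {T : finType} (w : T -> R) n F G :
  (forall t, 0 <= w t) ->
  (forall s, size s = n -> F s <= G s) -> walk_sum w n F <= walk_sum w n G.
Proof.
move=> w0; elim: n F G => [|n IH] F G FG /=; first exact: FG.
apply: ler_sum => t _; apply: ler_wpM2l => //; apply: IH => s sn.
by apply: FG; rewrite /= sn.
Qed.

Lemma walk_sum_ge0 {R : realType} {T : finType} (w : T -> R) n F :
  (forall t, 0 <= w t) -> (forall s, 0 <= F s) -> 0 <= walk_sum w n F.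
Proof.
move=> w0; elim: n F => [|n IH] F F0 //=.
by apply: sumr_ge0 => t _; rewrite mulr_ge0// IH.
Qed.

Lemma walk_sum_prod {R : realType} {T : finType} (w : T -> R) n (g : T -> R) :
  walk_sum w n (fun s => \prod_(t <- s) g t) = (\sum_t w t * g t) ^+ n.
Proof.
elim: n => [|n IH]; first by rewrite /= big_nil expr0.
rewrite /= exprS -IH mulr_suml; apply: eq_bigr => t _.
rewrite -mulrA; congr *%R; rewrite -walk_sumZ; apply: eq_walk_sum => s.
by rewrite big_cons.
Qed.

Lemma sum_by_value {R : realType} {T : finType} (P : pred T) (w : T -> R)
    (c : T -> nat) (g : nat -> R) : (forall t, (c t <= 2)%N) ->
  \sum_(t | P t) w t * g (c t) =
  (\sum_(t | P t && (c t == 0%N)) w t) * g 0%N +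
  (\sum_(t | P t && (c t == 1%N)) w t) * g 1%N +
  (\sum_(t | P t && (c t == 2)) w t) * g 2.
Proof.
move=> c2; rewrite !mulr_suml.
rewrite (bigID (fun t => c t == 0%N)) /= -addrA; congr +%R.
  by apply: eq_bigr => t /andP[_ /eqP ->].
rewrite (bigID (fun t => c t == 1%N)) /=; congr +%R.
  rewrite big_mkcond [RHS]big_mkcond; apply: eq_bigr => t _.
  by case: (P t) => //=; have := c2 t; case: (c t) => [|[|[|]]].
rewrite big_mkcond [RHS]big_mkcond; apply: eq_bigr => t _.
by case: (P t) => //=; have := c2 t; case: (c t) => [|[|[|]]].
Qed.

(* [kappa] records what is known of a step before the sign of its move is
   revealed; the hypothesis says that this sign is then a fair coin. *)
Lemma walk_sum_stays {R : realType} {T C : finType} (w : T -> R) (c : T -> nat)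
    (kappa : T -> C) :
  (forall t, (c t <= 2)%N) ->
  (forall x, \sum_(t | (kappa t == x) && (c t == 0%N)) w t =
             \sum_(t | (kappa t == x) && (c t == 2)) w t) ->
  forall n h (G : seq C -> R),
  walk_sum w n (fun s => G (map kappa s) * (stays c h s)%:R) =
  walk_sum w n (fun s => G (map kappa s) * stay_prob R (moves c s) h).
Proof.
move=> c2 csym; elim=> [|n IH] [|h] G.
- by rewrite /= stay_prob0.
- by rewrite /= /stay_prob /= expr0 divr1.
- by apply: eq_walk_sum => -[|t s] /=; rewrite stay_prob0.
transitivity (\sum_t w t * walk_sum w n (fun s =>
    G (kappa t :: map kappa s) * stay_prob R (moves c s) (h + c t))).
  apply: eq_bigr => t _; congr *%R.
  by rewrite -(IH (h + c t)%N (fun s => G (kappa t :: s))); apply: eq_walk_sum.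
rewrite /=; under eq_bigr do rewrite -walk_sumZ.
under [RHS]eq_bigr do rewrite -walk_sumZ.
rewrite -!walk_sum_sum; apply: eq_walk_sum => s.
rewrite (partition_big kappa xpredT)//= [RHS](partition_big kappa xpredT)//=.
apply: eq_bigr => x _; rewrite /= -/(moves c s).
(* For a first step with [c t = i], [q0] is what the induction hypothesis yields and [q1] what is
   wanted. They agree at [i = 1]; at [i = 0] and [i = 2], which carry equal weight within the class
   [x], only their sums agree, by [stay_probS]. *)
pose q0 i := G (x :: map kappa s) * stay_prob R (moves c s) (h + i).
pose q1 i := G (x :: map kappa s) *
  stay_prob R ((i != 1%N) + moves c s) h.+1.
transitivity (\sum_(t | kappa t == x) w t * q0 (c t)).
  by apply: eq_bigr => t /eqP ->.
transitivity (\sum_(t | kappa t == x) w t * q1 (c t)); last first.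
  by apply: eq_bigr => t /eqP ->.
rewrite !sum_by_value// csym /q0 /q1 /= add0n add1n !stay_probS addn0 addn1 addn2.
by field.
Qed.

(** * Wallis' product *)

(* The antiderivative of [cos ^+ n] vanishing at 0, so that its value at
   [pi / 2] is Wallis' integral. *)
Fixpoint cos_pow_primitive (R : realType) (n : nat) : R -> R :=
  match n with
  | 0%N => id
  | 1%N => sin
  | (m.+1 as k).+1 => fun x =>
      (cos x ^+ k * sin x + k%:R * cos_pow_primitive R m x) / k.+1%:R
  end.

Lemma is_derive_cos_pow_primitive (R : realType) n (x : R) :
  is_derive x 1 (cos_pow_primitive R n) (cos x ^+ n).
Proof.
(* The recursion descends by two, so the induction carries two consecutive exponents. *)
have [//] : is_derive x 1 (cos_pow_primitive R n) (cos x ^+ n) /\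
  is_derive x 1 (cos_pow_primitive R n.+1) (cos x ^+ n.+1).
elim: n => [|n [IH IH1]].
  split; rewrite ?expr0 ?expr1 /=; first exact: is_derive_id.
  exact: is_derive_sin.
split=> //.
have -> : cos_pow_primitive R n.+2 = (n.+2%:R^-1 : R) *:
    ((@cos R ^+ n.+1) * @sin R + (n.+1%:R : R) *: cos_pow_primitive R n).
  apply/funext => y /=.
  by rewrite !fctE mulrC; congr (_ * (_ * _ + _)).
apply: is_derive_eq.
rewrite /GRing.scale /= exprfctE.
have sc : sin x * sin x = 1 - cos x ^+ 2 by rewrite -(cos2Dsin2 x); ring.
have -> : forall a c : R, sin x * (a * c * - sin x) = - (a * c * (sin x * sin x)).
  by move=> *; ring.
rewrite sc.
have n0 : n.+2%:R != 0 :> R by rewrite pnatr_eq0.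
apply: (mulfI n0); rewrite mulrA divff// mul1r !exprS -[n.+2%:R]natr1; ring.
Qed.

Lemma cos_pow_primitive0 (R : realType) n : cos_pow_primitive R n 0 = 0.
Proof.
have [//] : cos_pow_primitive R n 0 = 0 /\ cos_pow_primitive R n.+1 0 = 0.
elim: n => [|n [IH IH1]]; first by rewrite /= sin0.
by split=> //=; rewrite IH sin0 !mulr0 addr0 mul0r.
Qed.

Lemma pihalf_ge0 (R : realType) : 0 <= pi / 2 :> R.
Proof. by rewrite divr_ge0// pi_ge0. Qed.

(** Since the cosine lies in [[0, 1]] on [[0, pi / 2]], the difference of the two primitives has a
    nonnegative derivative there, and it vanishes at [0]. *)
Lemma cos_pow_primitive_decr (R : realType) n :
  cos_pow_primitive R n.+1 (pi / 2) <= cos_pow_primitive R n (pi / 2).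
Proof.
rewrite -subr_ge0.
pose f : R -> R := cos_pow_primitive R n - cos_pow_primitive R n.+1.
have df (x : R) : is_derive x 1 f (cos x ^+ n - cos x ^+ n.+1).
  by apply: is_deriveB; exact: is_derive_cos_pow_primitive.
suff : f 0 <= f (pi / 2) by rewrite /f !fctE !cos_pow_primitive0 subrr.
apply: (@ger0_derive1_ndecr _ f 0 (pi / 2)) => //; last exact: pihalf_ge0.
- move=> x; rewrite in_itv /= => /andP[x0 xpi].
  rewrite derive1E (@derive_val _ _ _ _ _ _ _ (df x)).
  have c0 : 0 <= cos x by apply: cos_ge0_pihalf; have := @pi_ge0 R; lra.
  by rewrite subr_ge0 exprS ler_piMl ?exprn_ge0// cos_le1.
- apply/continuous_subspaceT => x.
  by apply: differentiable_continuous; apply/derivable1_diffP.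
Qed.

Definition wallis (R : realType) n : R := cos_pow_primitive R n (pi / 2).

Lemma wallisSS (R : realType) n :
  wallis R n.+2 = n.+1%:R / n.+2%:R * wallis R n.
Proof. by rewrite /wallis /= cos_pihalf exprS !mul0r add0r mulrAC. Qed.

(** The probability that a simple walk is back at its start after [2j] steps. *)
Definition central_binomial_prob (R : realType) (j : nat) : R :=
  'C(j.*2, j)%:R / 4 ^+ j.

Lemma central_binomialS j :
  (j.+1 * 'C(j.+1.*2, j.+1) = 2 * j.*2.+1 * 'C(j.*2, j))%N.
Proof.
have h1 := mul_bin_diag (j.*2.+2) j; have h2 := mul_bin_down (j.*2.+1) j.
have h3 : (j.*2.+2 * 'C(j.*2.+1, j) = j.+1 * 'C(j.*2.+2, j.+1))%N by exact: h1.
have e : (j.*2.+1 - j = j.+1)%N by lia.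
rewrite e in h2; rewrite doubleS.
have := h2; have := h3; rewrite /=.
set a := 'C(_, _); set b := 'C(_, _); set c := 'C(_, _).
nia.
Qed.

Lemma central_binomial_probS (R : realType) j :
  central_binomial_prob R j.+1 =
  j.*2.+1%:R / j.*2.+2%:R * central_binomial_prob R j.
Proof.
rewrite /central_binomial_prob.
have /(congr1 (fun n => n%:R : R)) := central_binomialS j; rewrite !natrM => h.
have j0 : j.+1%:R != 0 :> R by rewrite pnatr_eq0.
have -> : 'C(j.+1.*2, j.+1)%:R = 2 * j.*2.+1%:R * 'C(j.*2, j)%:R / j.+1%:R :> R.
  by apply: (mulfI j0); rewrite h; field.
have -> : j.*2.+2%:R = 2 * j.+1%:R :> R by rewrite -natrM mul2n doubleS.
rewrite exprS; move: (j.+1%:R) (j.*2.+1%:R) j0 => k l k0; field.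
by rewrite k0 expf_neq0.
Qed.

Lemma central_binomial_prob_gt0 (R : realType) j : 0 < central_binomial_prob R j.
Proof. by rewrite divr_gt0// ltr0n bin_gt0; lia. Qed.

Lemma wallis_even (R : realType) j :
  wallis R j.*2 = pi / 2 * central_binomial_prob R j.
Proof.
elim: j => [|j IH]; first by rewrite /central_binomial_prob expr0 divr1 mulr1.
by rewrite doubleS wallisSS IH central_binomial_probS mulrCA.
Qed.

Lemma wallis_odd (R : realType) j :
  wallis R j.*2.+1 = (j.*2.+1%:R * central_binomial_prob R j)^-1.
Proof.
elim: j => [|j IH].
  by rewrite /wallis /= sin_pihalf /central_binomial_prob expr0 divr1 mulr1 invr1.
rewrite doubleS wallisSS IH central_binomial_probS.
have := central_binomial_prob_gt0 R j => /lt0r_neq0 b0.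
move: (central_binomial_prob R j) b0 => b b0; field.
have k0 : 0 <= j.*2%:R :> R by [].
by rewrite b0 !lt0r_neq0 //; lra.
Qed.

(** Wallis' integral of exponent [2j + 1] is at most that of exponent [2j]; both are explicit in the
    return probability. *)
Lemma central_binomial_prob_lb (R : realType) j :
  2 <= pi * j.*2.+1%:R * central_binomial_prob R j ^+ 2.
Proof.
have b0 := central_binomial_prob_gt0 R j.
have := cos_pow_primitive_decr R j.*2.
rewrite -!/(wallis R _) wallis_odd wallis_even.
have kb0 : 0 < j.*2.+1%:R * central_binomial_prob R j by exact: mulr_gt0.
rewrite -[_^-1]mul1r ler_pdivrMr//.
lra.
Qed.

(** For [j > 0], this compares the integrals of exponents [2j] and [2j - 1], the latter being
    rewritten through the return probability at [j]. *)
Lemma central_binomial_prob_ub (R : realType) j :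
  pi * j.*2%:R * central_binomial_prob R j ^+ 2 <= 2.
Proof.
case: j => [|j]; first by rewrite mulr0 mul0r.
have b0 := central_binomial_prob_gt0 R j.
have := cos_pow_primitive_decr R j.*2.+1.
rewrite -!/(wallis R _) wallis_odd -doubleS wallis_even.
move: (central_binomial_probS R j) b0 (central_binomial_prob_gt0 R j.+1).
move: (central_binomial_prob R j) (central_binomial_prob R j.+1) => b b'.
rewrite doubleS => e b0 b'0.
have -> : j.*2.+1%:R * b = j.*2.+2%:R * b'.
  by rewrite e mulrA [_ * (_ / _)]mulrC divfK ?pnatr_eq0.
have kb0 : 0 < j.*2.+2%:R * b' by exact: mulr_gt0.
rewrite -[leRHS]mul1r ler_pdivlMr//; lra.
Qed.

Lemma stay_prob_double (R : realType) j :
  stay_prob R j.*2 1 = central_binomial_prob R j.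
Proof.
rewrite /stay_prob stay_count1 /central_binomial_prob.
have -> : (j.*2.+1)./2 = j by lia.
by rewrite -mul2n exprM -natrX.
Qed.

(** A nonnegative walk is strictly positive at odd times, so its next step cannot make it leave:
    lengths [2j + 1] and [2j + 2] have the same probability. *)
Lemma stay_prob_doubleS (R : realType) j :
  stay_prob R j.*2.+1 1 = central_binomial_prob R j.+1.
Proof.
rewrite /stay_prob stay_count1 /central_binomial_prob doubleS.
have -> : (j.*2.+2)./2 = j.+1 by lia.
have -> : 'C(j.*2.+2, j.+1) = (2 * 'C(j.*2.+1, j.+1))%N.
  have := bin_sub (leqW (leq_addr j j)); rewrite addnn.
  have -> : (j.*2.+1 - j = j.+1)%N by lia.
  by move=> e; rewrite binS e addnn mul2n.
rewrite natrM.
have -> : 4 ^+ j.+1 = 2 * 2 ^+ j.*2.+1 :> R.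
  by rewrite -exprS -doubleS -mul2n exprM; congr (_ ^+ _); rewrite -natrX.
by rewrite -mulf_div divff ?mul1r.
Qed.

(** Both parities reduce to the central binomial bounds; the shift [m.+2] is the one produced by odd
    [m]. *)
Lemma stay_prob_bounds (R : realType) m :
  2 <= pi * (m.+2)%:R * stay_prob R m 1 ^+ 2 /\
  pi * m%:R * stay_prob R m 1 ^+ 2 <= 2.
Proof.
have le k l (b : R) : (k <= l)%N -> pi * k%:R * b ^+ 2 <= pi * l%:R * b ^+ 2.
  by move=> kl; rewrite ler_wpM2r ?sqr_ge0// ler_wpM2l ?pi_ge0// ler_nat.
rewrite -(odd_double_half m); move: (m./2) => j.
case: (odd m); rewrite /= ?add1n ?add0n.
  rewrite stay_prob_doubleS; split.
    by rewrite -doubleS; apply: central_binomial_prob_lb.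
  apply: (le_trans (le _ j.+1.*2 _ _)); last exact: central_binomial_prob_ub.
  by rewrite doubleS.
rewrite stay_prob_double; split; last exact: central_binomial_prob_ub.
by apply: (le_trans (central_binomial_prob_lb R _)); apply: le.
Qed.

(** * Concentration of the number of moves *)

(** Compare both sides with [1 / (1 - x)], which dominates [expR x] because
    [1 - x <= expR (- x)]. *)
Lemma expR_le_quadratic (R : realType) (x : R) :
  `|x| <= 2^-1 -> expR x <= 1 + x + 2 * x ^+ 2.
Proof.
rewrite ler_norml => /andP[x1 x2].
have h : expR x <= (1 - x)^-1.
  rewrite -[x in expR x]opprK expRN lef_pV2 ?posrE ?expR_gt0 //; last by lra.
  exact: expR_ge1Dx.
apply: (le_trans h); rewrite -[_^-1]mul1r ler_pdivrMr; last by lra.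
have x20 : 0 <= x ^+ 2 by exact: sqr_ge0.
have -> : (1 + x + 2 * x ^+ 2) * (1 - x) = 1 + x ^+ 2 * (1 - 2 * x) by ring.
by rewrite lerDl mulr_ge0//; lra.
Qed.

Lemma sum_moves (R : realType) (T : Type) (c : T -> nat) s (a : R) :
  \sum_(t <- s) ((c t != 1%N)%:R - a) = (moves c s)%:R - (size s)%:R * a.
Proof.
elim: s => [|t s IH]; first by rewrite big_nil mul0r subrr.
by rewrite big_cons IH /= natrD -natr1 -/(moves c s); ring.
Qed.

(** The exponential moment factors over the steps. A centred indicator has mean zero and absolute
    value at most [1], so each factor is at most [1 + 2 * l ^+ 2]. *)
Lemma walk_sum_expR {R : realType} {T : finType} (w : T -> R) (c : T -> nat)
    (n : nat) (a l : R) :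
  (forall t, 0 <= w t) -> \sum_t w t = 1 ->
  a = \sum_(t | c t != 1%N) w t -> `|l| <= 2^-1 ->
  walk_sum w n (fun s => expR (l * ((moves c s)%:R - n%:R * a))) <=
  expR (n%:R * (2 * l ^+ 2)).
Proof.
move=> w0 w1 aE l2.
pose g t : R := (c t != 1%N)%:R - a.
have a0 : 0 <= a by rewrite aE sumr_ge0.
have a1 : a <= 1.
  by rewrite aE -w1 [leRHS](bigID (fun t => c t != 1%N))/= lerDl sumr_ge0.
have Eg : \sum_t w t * g t = 0.
  rewrite /g; under eq_bigr do rewrite mulrBr.
  rewrite sumrB -mulr_suml w1 mul1r aE [X in _ - X]big_mkcond.
  apply/eqP; rewrite subr_eq0; apply/eqP; apply: eq_bigr => t _.
  by case: ifP; rewrite ?mulr1 ?mulr0.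
have g1 t : `|g t| <= 1.
  by rewrite ler_norml /g; case: (c t != 1%N); rewrite /=; lra.
have step : \sum_t w t * expR (l * g t) <= expR (2 * l ^+ 2).
  apply: (@le_trans _ _ (\sum_t w t * (1 + l * g t + 2 * l ^+ 2))).
    apply: ler_sum => t _; apply: ler_wpM2l => //.
    have lg : `|l * g t| <= `|l|.
      by rewrite normrM ler_piMr.
    apply: (le_trans (expR_le_quadratic _ _ (le_trans lg l2))).
    rewrite lerD2l ler_pM2l// -[leLHS]real_normK ?num_real//.
    by rewrite -[leRHS]real_normK ?num_real// ler_pXn2r// nnegrE.
  rewrite (eq_bigr (fun t => w t * (1 + 2 * l ^+ 2) + l * (w t * g t)));
    last by move=> t _; ring.
  rewrite big_split -mulr_suml -mulr_sumr /= w1 Eg mulr0 addr0 mul1r.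
  exact: expR_ge1Dx.
rewrite expRM_natl.
apply: (le_trans _ (lerXn2r n _ _ step)); last 2 first.
- by rewrite nnegrE sumr_ge0// => t _; rewrite mulr_ge0// expR_ge0.
- by rewrite nnegrE expR_ge0.
rewrite -walk_sum_prod; apply: le_walk_sum => // s sn.
rewrite -expR_sum -mulr_sumr sum_moves sn; exact: lexx.
Qed.

(** Chernoff's bound: the indicator of a deviation is dominated by two exponentials, one for each
    tail. *)
Lemma walk_sum_deviation {R : realType} {T : finType} (w : T -> R)
    (c : T -> nat) (n : nat) (a e : R) :
  (forall t, 0 <= w t) -> \sum_t w t = 1 ->
  a = \sum_(t | c t != 1%N) w t -> 0 < e -> e <= 1 ->
  walk_sum w n (fun s => (e * n%:R < `|(moves c s)%:R - n%:R * a|)%R%:R) <=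
  2 * expR (- (n%:R * (e ^+ 2 / 8))).
Proof.
move=> w0 w1 aE e0 e1.
(* This [x] minimises the exponent [2 * x ^+ 2 - x * e], with value [- e ^+ 2 / 8]. *)
pose x := e / 4; pose D s : R := (moves c s)%:R - n%:R * a.
have x2 : `|x| <= 2^-1 by rewrite ger0_norm /x; lra.
have x2N : `|- x| <= 2^-1 by rewrite normrN.
pose k : R := expR (- (x * (e * n%:R))).
apply: (@le_trans _ _ (walk_sum w n (fun s =>
   k * expR (x * D s) + k * expR (- x * D s)))).
  apply: le_walk_sum => // s _; rewrite -/(D s) -!expRD.
  case: (boolP (e * n%:R < `|D s|)) => [|_]; last by rewrite addr_ge0// expR_ge0.
  have x0 : 0 < x by rewrite /x; lra.
  have big y : e * n%:R < y -> 1 <= expR (- (x * (e * n%:R)) + x * y).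
    by move=> h; rewrite -[leLHS]expR0 ler_expR addrC -mulrBr;
       rewrite mulr_ge0 ?(ltW x0)// subr_ge0 ltW.
  rewrite ltr_normr => /orP[] /big h.
    by apply: (le_trans h); rewrite lerDl expR_ge0.
  by apply: (le_trans h); rewrite mulNr -mulrN lerDr expR_ge0.
rewrite walk_sumD !walk_sumZ.
have hk : expR (- (n%:R * (e ^+ 2 / 8))) = k * expR (n%:R * (2 * x ^+ 2)).
  by rewrite /k -expRD /x; congr expR; field.
rewrite hk mulr2n mulrDl !mul1r lerD// ler_wpM2l ?expR_ge0//.
  exact: walk_sum_expR.
by rewrite -sqrrN; apply: walk_sum_expR.
Qed.

(** * Asymptotics along one coordinate *)

(** The bounds on [stay_prob] control the square of [sqrt n * stay_prob], and dividing a difference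
    of squares by the positive limit controls the difference itself. The term [2 / n] pays for
    [m.+2] in place of [m]. *)
Lemma stay_prob_near {R : realType} (a e : R) (n m : nat) :
  0 < a -> 0 < e -> e <= a / 2 -> (0 < n)%N ->
  `|m%:R - n%:R * a| <= e * n%:R ->
  `|Num.sqrt n%:R * stay_prob R m 1 - Num.sqrt (2 / (pi * a))| <=
  2 * Num.sqrt (2 / (pi * a)) / a * (e + 2 / n%:R).
Proof.
move=> a0 e0 ea n0; rewrite {1}ler_norml => /andP[m1 m2].
have [lb ub] := stay_prob_bounds R m.
have pi0 : 0 < pi :> R := pi_gt0 R.
set k := Num.sqrt (2 / (pi * a)).
have k0 : 0 < k by rewrite sqrtr_gt0 divr_gt0// mulr_gt0.
have k2 : k ^+ 2 * (pi * a) = 2.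
  by rewrite sqr_sqrtr ?divr_ge0 ?mulr_ge0 ?ltW// divfK// mulf_neq0 ?gt_eqF.
have q0 := stay_prob_ge0 R m 1.
move: lb ub; have -> : m.+2%:R = m%:R + 2 :> R by rewrite -natrD addn2.
move: (stay_prob R m 1) q0 => q q0 lb ub.
have n1 : 0 < n%:R :> R by rewrite ltr0n.
set u := Num.sqrt n%:R * q.
have u0 : 0 <= u by rewrite mulr_ge0// sqrtr_ge0.
have u2 : u ^+ 2 = n%:R * q ^+ 2 by rewrite exprMn sqr_sqrtr// ltW.
pose Q := pi * q ^+ 2.
have Q0 : 0 <= Q by rewrite mulr_ge0 ?sqr_ge0// ltW.
have uQ : u ^+ 2 * (pi * a) = a * n%:R * Q by rewrite u2 /Q; ring.
have lbQ : 2 <= (m%:R + 2) * Q.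
  by apply: (le_trans lb); rewrite /Q le_eqVlt; apply/orP; left; apply/eqP; ring.
have ubQ : m%:R * Q <= 2.
  by apply: le_trans ub; rewrite /Q le_eqVlt; apply/orP; left; apply/eqP; ring.
(* Here [e <= a / 2] enters: it forces [m] to be at least [n * a / 2]. *)
have nQ : a * (n%:R * Q) <= 4.
  have : (m%:R - a / 2 * n%:R) * Q >= 0.
    rewrite mulr_ge0//.
    have : e * n%:R <= a / 2 * n%:R by rewrite ler_wpM2r// ltW.
    lra.
  lra.
have d1 : a * n%:R * Q - 2 <= e * (n%:R * Q).
  have : (e * n%:R - (n%:R * a - m%:R)) * Q >= 0 by rewrite mulr_ge0//; lra.
  lra.
have d2 : 2 - a * n%:R * Q <= e * (n%:R * Q) + 2 * Q.
  have : (e * n%:R + n%:R * a - m%:R) * Q >= 0 by rewrite mulr_ge0//; lra.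
  lra.
have bd : a * (e * (n%:R * Q) + 2 * Q) <= 4 * (e + 2 / n%:R).
  have -> : a * (e * (n%:R * Q) + 2 * Q) = (a * (n%:R * Q)) * (e + 2 / n%:R).
    by field; rewrite gt_eqF.
  by rewrite ler_wpM2r// addr_ge0// ?divr_ge0// ltW.
have main : `|u ^+ 2 - k ^+ 2| * (pi * a ^+ 2) <= 4 * (e + 2 / n%:R).
  apply: le_trans bd.
  have -> : `|u ^+ 2 - k ^+ 2| * (pi * a ^+ 2) =
      a * `|u ^+ 2 * (pi * a) - k ^+ 2 * (pi * a)|.
    rewrite -mulrBl normrM [X in _ = _ * (_ * X)]ger0_norm; first by ring.
    by rewrite mulr_ge0// ltW.
  rewrite uQ k2 ler_wpM2l ?(ltW a0)//.
  by rewrite ler_norml; have := mulr_ge0 (ler0n R 2) Q0; lra.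
have hk : `|u - k| * k <= `|u ^+ 2 - k ^+ 2|.
  rewrite subr_sqr normrM ler_wpM2l// ger0_norm ?addr_ge0 ?(ltW k0)//.
  by rewrite lerDr.
have pa0 : 0 < pi * a ^+ 2 by rewrite mulr_gt0 ?exprn_gt0.
rewrite -(ler_pM2r k0); apply: (le_trans hk); rewrite -(ler_pM2r pa0).
apply: (le_trans main).
have -> : 2 * k / a * (e + 2 / n%:R) * k * (pi * a ^+ 2) =
   2 * (k ^+ 2 * (pi * a)) * (e + 2 / n%:R).
  by field; rewrite !gt_eqF.
rewrite k2 le_eqVlt; apply/orP; left; apply/eqP; ring.
Qed.

Lemma inv_le_harmonic (R : realType) (n : nat) :
  (0 < n)%N -> n%:R^-1 <= 2 * harmonic n :> R.
Proof.
move=> n0; rewrite /harmonic -[_^-1]mul1r ler_pdivrMr ?ltr0n//.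
rewrite mulrAC ler_pdivlMr ?ltr0Sn// mul1r -natrM ler_nat; lia.
Qed.

(** One term of the exponential series bounds [expR (n * b)] below by a multiple of [n ^ (m + 1)],
    while [sqrt n ^ m] is at most [n ^ m]; the quotient is [O(1 / n)]. *)
Lemma cvg_sqrt_pow_expR (R : realType) (m : nat) (b : R) : 0 < b ->
  (fun n : nat => Num.sqrt (n%:R : R) ^+ m * expR (- (n%:R * b))) @ \oo
    --> (0 : R).
Proof.
move=> b0; pose K : R := (m.+1)`!%:R / b ^+ m.+1.
have K0 : 0 < K by rewrite divr_gt0 ?exprn_gt0// ltr0n fact_gt0.
have hK : (fun n => (K * 2) * harmonic n) @ \oo --> (0 : R).
  rewrite -[0](mulr0 (K * 2)); apply: cvgM; first exact: cvg_cst.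
  exact: cvg_harmonic.
apply: (squeeze_cvgr _ (cvg_cst 0) hK).
exists 1%N => // n /= n0.
have n1 : 1 <= n%:R :> R by rewrite ler1n.
have n1' : 0 < n%:R :> R by rewrite ltr0n.
rewrite mulr_ge0 ?exprn_ge0 ?sqrtr_ge0 ?expR_ge0//=.
apply: (@le_trans _ _ (n%:R ^+ m * (K / n%:R ^+ m.+1))).
  apply: ler_pM; rewrite ?exprn_ge0 ?sqrtr_ge0 ?expR_ge0//.
    rewrite lerXn2r// ?nnegrE ?sqrtr_ge0//.
    rewrite -[leRHS]ger0_norm ?ler0n// -sqrtr_sqr ler_wsqrtr// expr2 ler_peMr//.
  rewrite expRN -[K / _]invrK lef_pV2 ?posrE
           ?expR_gt0 ?invr_gt0 ?divr_gt0 ?exprn_gt0//.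
  apply: le_trans (expR_ge1Dxn m _); last by rewrite mulr_ge0 ?ltW.
  rewrite -[leLHS]add0r lerD//.
  by rewrite /K !invf_div mulrA exprMn.
have -> : n%:R ^+ m * (K / n%:R ^+ m.+1) = K / n%:R.
  have n2 := lt0r_neq0 n1'.
  rewrite exprS; move: (n%:R) n2 => x x0.
  by field; rewrite x0 expf_neq0.
by rewrite -mulrA ler_wpM2l ?(ltW K0)// inv_le_harmonic.
Qed.

(** Inserts the factor of one coordinate. [F] may be correlated with the moves: outside an
    exponentially rare set of words, [sqrt n] times the new factor is uniformly close to a
    constant. *)
Lemma cvg_walk_sum_stay_prob {R : realType} {T : finType} (w : T -> R)
    (c : T -> nat) (a : R) (F : seq T -> R) (m : nat) (l : R) :
  (forall t, 0 <= w t) -> \sum_t w t = 1 ->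
  a = \sum_(t | c t != 1%N) w t -> 0 < a ->
  (forall s, 0 <= F s <= 1) ->
  (fun n : nat => Num.sqrt (n%:R : R) ^+ m * walk_sum w n F) @ \oo --> l ->
  (fun n : nat => Num.sqrt (n%:R : R) ^+ m.+1 *
     walk_sum w n (fun s => F s * stay_prob R (moves c s) 1)) @ \oo -->
  Num.sqrt (2 / (pi * a)) * l.
Proof.
move=> w0 w1 aE a0 F01 vl.
set k := Num.sqrt (2 / (pi * a)).
have k0 : 0 <= k by exact: sqrtr_ge0.
pose v n := Num.sqrt (n%:R : R) ^+ m * walk_sum w n F.
have l0 : 0 <= l.
  apply: (cvgr_to_ge vl); apply: nearW => n.
  rewrite mulr_ge0 ?exprn_ge0 ?sqrtr_ge0//; apply: walk_sum_ge0 => // s.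
  by case/andP: (F01 s).
pose K := 2 * k / a.
have K0 : 0 <= K by rewrite /K divr_ge0 ?mulr_ge0// ltW.
(* The first term accounts for typical words and tends to [K * e * l]; the second accounts for
   deviating words and tends to [0]. *)
pose err (e : R) n := K * (e + 4 * harmonic n) * v n +
  2 * (Num.sqrt (n%:R : R) ^+ m.+1 * expR (- (n%:R * (e ^+ 2 / 8))) +
       k * (Num.sqrt (n%:R : R) ^+ m * expR (- (n%:R * (e ^+ 2 / 8))))).
have errP e : 0 < e -> e <= 1 -> e <= a / 2 -> forall n, (0 < n)%N ->
  `|Num.sqrt (n%:R : R) ^+ m.+1 *
     walk_sum w n (fun s => F s * stay_prob R (moves c s) 1) - k * v n|
  <= err e n.
  move=> e0 e1 ea n n0.
  pose B s : R := (e * n%:R < `|(moves c s)%:R - n%:R * a|)%R%:R.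
  pose D s := F s * (Num.sqrt n%:R * stay_prob R (moves c s) 1 - k).
  pose G s := K * (e + 4 * harmonic n) * F s + (Num.sqrt n%:R + k) * B s.
  have sn0 : 0 <= Num.sqrt (n%:R : R) by exact: sqrtr_ge0.
  have eh0 : 0 <= e + 4 * harmonic n.
    by rewrite addr_ge0 ?mulr_ge0 ?harmonic_ge0 ?(ltW e0).
  (* Deviating words only get the trivial bound [sqrt n + k], typical ones that of
     [stay_prob_near]. *)
  have DG s : `|D s| <= G s.
    have /andP[f0 f1] := F01 s.
    have q0 := stay_prob_ge0 R (moves c s) 1.
    have q1 := stay_prob_le1 R (moves c s) 1.
    rewrite normrM (ger0_norm f0) /G /B; case: ltP => [h|h].
      rewrite mulr1; apply: (@le_trans _ _ (Num.sqrt n%:R + k)).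
        apply: (le_trans (ler_piMl _ f1)) => //.
        apply: (le_trans (ler_normB _ _)).
        by rewrite (ger0_norm k0) ger0_norm ?mulr_ge0// lerD2r ler_piMr.
      by rewrite lerDr; exact: mulr_ge0 (mulr_ge0 K0 eh0) f0.
    rewrite mulr0 addr0 mulrC ler_wpM2r//.
    apply: (le_trans (stay_prob_near a e n (moves c s) a0 e0 ea n0 h)).
    rewrite -/k -/K ler_wpM2l// lerD2l.
    by have := inv_le_harmonic R n n0; lra.
  have ED : Num.sqrt (n%:R : R) ^+ m.+1 *
     walk_sum w n (fun s => F s * stay_prob R (moves c s) 1) - k * v n =
     Num.sqrt (n%:R : R) ^+ m * walk_sum w n D.
    rewrite /v exprSr -mulrA -walk_sumZ mulrCA -mulrBr -walk_sumZ.
    rewrite -[- walk_sum w n _]mulN1r -walk_sumZ -walk_sumD; congr *%R; apply: eq_walk_sum => s.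
    by rewrite /D; ring.
  have EG : Num.sqrt (n%:R : R) ^+ m * walk_sum w n G <= err e n.
    rewrite /G walk_sumD !walk_sumZ mulrDr mulrCA -/(v n) /err lerD2l.
    have := walk_sum_deviation w c n a e w0 w1 aE e0 e1; rewrite -/(B) => h.
    rewrite [leRHS](_ : _ = Num.sqrt n%:R ^+ m * ((Num.sqrt n%:R + k) *
      (2 * expR (- (n%:R * (e ^+ 2 / 8)))))); last first.
      by rewrite [_ ^+ m.+1]exprSr; ring.
    by rewrite !ler_wpM2l ?exprn_ge0 ?addr_ge0.
  rewrite ED; apply: le_trans EG.
  rewrite normrM ger0_norm ?exprn_ge0// ler_wpM2l ?exprn_ge0//.
  rewrite ler_norml; apply/andP; split.
    rewrite -mulN1r -walk_sumZ; apply: le_walk_sum => // s _.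
    by have := DG s; rewrite ler_norml => /andP[]; lra.
  apply: le_walk_sum => // s _.
  by have := DG s; rewrite ler_norml => /andP[].
have err_cvg e : 0 < e -> err e @ \oo --> K * (e + 4 * 0) * l + 2 * (0 + k * 0).
  move=> e0; have e2 : 0 < e ^+ 2 / 8 by rewrite divr_gt0 ?exprn_gt0.
  apply: cvgD; apply: cvgM => //; try exact: cvg_cst.
    apply: cvgM; first exact: cvg_cst.
    apply: cvgD; first exact: cvg_cst.
    by apply: cvgM; [exact: cvg_cst|exact: cvg_harmonic].
  apply: cvgD; first exact: cvg_sqrt_pow_expR.
  by apply: cvgM; [exact: cvg_cst|exact: cvg_sqrt_pow_expR].
have kv : (fun n => k * v n) @ \oo --> k * l.
  by apply: cvgM => //; exact: cvg_cst.
rewrite -[k * l]add0r.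
set f := (X in X @ _ --> _).
have -> : f = (fun n => (f n - k * v n) + k * v n).
  by apply/funext => n; rewrite subrK.
apply: cvgD => //.
apply/cvgr0Pnorm_le => eps eps0.
(* The choice of [e] below gives [e * b <= eps / 2]; the added [1] keeps [b] positive when
   [l = 0]. *)
pose b := K * l + 1.
have Kl0 : 0 <= K * l := mulr_ge0 K0 l0.
have b0 : 0 < b by rewrite /b; lra.
have b20 : 0 < 2 * b by lra.
pose e := Num.min (Num.min 1 (a / 2)) (eps / (2 * b)).
have e0 : 0 < e by rewrite !lt_min ltr01 (divr_gt0 eps0 b20) andbT /= divr_gt0.
have e1 : e <= 1 by rewrite !ge_min lexx.
have e2 : e <= a / 2 by rewrite !ge_min lexx orbT.
have e3 : e <= eps / (2 * b) by rewrite !ge_min lexx !orbT.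
have elim : K * (e + 4 * 0) * l + 2 * (0 + k * 0) < eps.
  rewrite !mulr0 !addr0 mulr0 addr0.
  apply: (@le_lt_trans _ _ (e * b)).
    by rewrite /b mulrAC mulrC ler_wpM2l ?(ltW e0)// lerDl.
  apply: (@le_lt_trans _ _ (eps / (2 * b) * b)); first by rewrite ler_wpM2r// ltW.
  by rewrite invfM mulrA divfK ?gt_eqF//; lra.
have := cvgr_lt _ (err_cvg e e0) eps elim.
move=> near_err; near=> n.
have n0 : (0 < n)%N by near: n; exists 1%N.
apply: (le_trans (errP e e0 e1 e2 n n0)); apply: ltW.
by near: n; exact: near_err.
Unshelve. all: end_near.
Qed.

(** * Walks in the orthant *)

Definition ffun_cons {T : finType} {n : nat} (t : T) (f : {ffun 'I_n -> T}) :
    {ffun 'I_n.+1 -> T} :=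
  [ffun i => oapp f t (unlift ord0 i)].

Lemma sum_ffunS {R : realType} {T : finType} n
    (H : {ffun 'I_n.+1 -> T} -> R) :
  \sum_f H f = \sum_t \sum_(f : {ffun 'I_n -> T}) H (ffun_cons t f).
Proof.
rewrite pair_bigA /=.
rewrite (reindex (fun p : T * {ffun 'I_n -> T} => ffun_cons p.1 p.2))//=.
exists (fun g => (g ord0, [ffun i => g (lift ord0 i)])) => [[t f]|g] _ /=.
  rewrite ffunE unlift_none /=; congr pair.
  by apply/ffunP => i; rewrite !ffunE liftK.
apply/ffunP => i; rewrite !ffunE; case: unliftP => [j ->|->] //=.
by rewrite ffunE.
Qed.

Lemma sum_ffun_walk_sum {R : realType} {T : finType} (w : T -> R) n F :
  \sum_(f : {ffun 'I_n -> T}) (\prod_i w (f i)) * F (map f (enum 'I_n)) =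
  walk_sum w n F.
Proof.
elim: n F => [|n IH] F.
  rewrite (big_pred1 (ffun0 (card_ord 0))); last first.
    by move=> f; apply/esym/eqP/ffunP => -[].
  rewrite big_ord0 mul1r /=; congr F; apply/eqP.
  by rewrite -size_eq0 size_map size_enum_ord.
rewrite sum_ffunS /=; apply: eq_bigr => t _.
rewrite -IH mulr_sumr; apply: eq_bigr => f _.
rewrite big_ord_recl mulrA enum_ordSl /= ffunE unlift_none /=.
congr (_ * _ * F (_ :: _)).
  by apply: eq_bigr => i _; rewrite ffunE liftK.
by rewrite -map_comp; apply: eq_map => i /=; rewrite ffunE liftK.
Qed.

(** The predecessor in [stays] matters only at positive heights, where it does not truncate, so
    heights shifted by one follow the integer partial sums. *)
Lemma staysP {T : Type} (c : T -> nat) (h : nat) (s : seq T) :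
  reflect (forall m, (m <= size s)%N ->
             0 <= h%:Z + \sum_(t <- take m s) ((c t)%:Z - 1))
          (stays c h.+1 s).
Proof.
elim: s h => [|t s IH] h /=.
  by apply: ReflectT => m _; rewrite /= big_nil; lia.
rewrite -/(stays c (h + c t) s) /=.
case hc: (h + c t)%N => [|h''].
  apply: (iffP idP) => [|/(_ 1%N isT)]; first by case: (s).
  by rewrite /= take0 big_seq1; lia.
apply: (iffP (IH _)) => H m ms.
  case: m ms => [|m] ms; first by rewrite big_nil; lia.
  have := H m ms; rewrite /= big_cons; lia.
have := H m.+1 ms; rewrite /= big_cons; lia.
Qed.

Lemma take_enum_ord n m : (m <= n)%N ->
  take m (enum 'I_n) = [seq i <- enum 'I_n | (val i < m)%N].
Proof.
move=> mn; apply: (inj_map val_inj).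
rewrite map_take -(filter_map val (fun i => (i < m)%N)) val_enum_ord.
rewrite -[m in RHS]add0n filter_iota_ltn//.
by rewrite take_iota; congr iota; lia.
Qed.

Definition step_coord {d : nat} (j : 'I_d) (s : step d) : nat := s j.

Lemma step_coord_le2 {d : nat} (j : 'I_d) (s : step d) : (step_coord j s <= 2)%N.
Proof. by rewrite /step_coord -ltnS ltn_ord. Qed.

Lemma quadrant_walkE d n (S : {set step d}) (f : {ffun 'I_n -> step d}) :
  quadrant_walk S f = [forall i, f i \in S] &&
    [forall j : 'I_d, stays (step_coord j) 1 (map f (enum 'I_n))].
Proof.
rewrite /quadrant_walk; congr andb.
have E (m : nat) (j : 'I_d) : (m <= n)%N ->
    \sum_(i < n | (i < m)%N) stepc (f i) j =
    \sum_(t <- take m (map f (enum 'I_n))) ((step_coord j t)%:Z - 1).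
  move=> mn; rewrite -map_take big_map take_enum_ord// big_filter.
  by rewrite big_enum_cond.
apply/forallP/forallP => [H j|H m].
  apply/staysP => m; rewrite size_map size_enum_ord => mn; rewrite add0r -E//.
  by have /forallP/(_ j) := H (Ordinal (mn : (m < n.+1)%N)).
apply/forallP => j; rewrite E; last by rewrite -ltnS.
have /staysP/(_ m) := H j; rewrite add0r; apply.
by rewrite size_map size_enum_ord -ltnS.
Qed.

(** Extension by zero turns sums over [S] into sums over the whole finite type, as [walk_sum]
    expects. *)
Definition step_weight {R : realType} {d : nat} (S : {set step d})
  (w : step d -> R) (s : step d) : R := if s \in S then w s else 0.

Lemma num_walks_walk_sum {R : realType} d (S : {set step d}) (w : step d -> R) n :
  num_walks S w n = walk_sum (step_weight S w) n
    (fun s => \prod_(j < d) (stays (step_coord j) 1 s)%:R).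
Proof.
rewrite -sum_ffun_walk_sum /num_walks big_mkcond; apply: eq_bigr => f _.
rewrite quadrant_walkE.
have [fS|] := boolP [forall i, f i \in S]; last first.
  rewrite negb_forall => /existsP[i fi].
  by rewrite /= (bigD1 i)//= /step_weight (negbTE fi) !mul0r.
have -> : \prod_i step_weight S w (f i) = \prod_i w (f i).
  by apply: eq_bigr => i _; rewrite /step_weight (forallP fS).
rewrite /=; case: ifPn => [/forallP st|].
  by rewrite [X in _ * X]big1 ?mulr1// => j _; rewrite st.
rewrite negb_forall => /existsP[j sj].
by rewrite (bigD1 j)//= (negbTE sj) mul0r mulr0.
Qed.

(** * Reflections and the fair sign of a move *)

Lemma stays_map {T T' : Type} (c : T' -> nat) (c' : T -> nat) (g : T -> T') h s :
  (forall t, c (g t) = c' t) -> stays c h (map g s) = stays c' h s.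
Proof. by move=> cg; elim: s h => //= t s IH h; rewrite IH cg. Qed.

Lemma moves_map {T T' : Type} (c : T' -> nat) (c' : T -> nat) (g : T -> T') s :
  (forall t, c (g t) = c' t) -> moves c (map g s) = moves c' s.
Proof.
by move=> cg; rewrite /moves count_map; apply: eq_count => t /=; rewrite cg.
Qed.

(* The step with the sign of its [k]-th coordinate forgotten. *)
Definition unsign {d : nat} (k : 'I_d) (s : step d) : step d :=
  [ffun i => if i == k
             then (if step_coord k s == 1%N then s k else ord0) else s i].

Lemma step_coord_reflect {d : nat} (k : 'I_d) (s : step d) :
  step_coord k (reflect_step k s) = (2 - step_coord k s)%N.
Proof. by rewrite /step_coord ffunE eqxx /= subSS. Qed.

Lemma unsign_reflect {d : nat} (k : 'I_d) (s : step d) :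
  unsign k (reflect_step k s) = unsign k s.
Proof.
apply/ffunP => i; rewrite !ffunE step_coord_reflect.
case: eqP => // _; have := step_coord_le2 k s; rewrite /step_coord eqxx.
case: eqP => e1 e2; case: eqP => e3 //; try lia.
by apply: val_inj; rewrite /= e3.
Qed.

Lemma reflect_stepK {d : nat} (k : 'I_d) : involutive (@reflect_step d k).
Proof.
by move=> s; apply/ffunP => i; rewrite !ffunE; case: eqP => // ->; rewrite rev_ordK.
Qed.

Lemma step_weight_reflect {R : realType} d (S : {set step d}) (w : step d -> R)
    k s :
  symmetric_axis S w k -> step_weight S w (reflect_step k s) = step_weight S w s.
Proof.
move=> sym; rewrite /step_weight.
case: ifPn => sS; first by have [] := sym _ sS; rewrite reflect_stepK => -> ->.
by case: ifPn => // /sym[rS]; rewrite rS in sS.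
Qed.

(** Reflection is a weight-preserving involution exchanging the two signs. Taking for [Q] a fibre of
    [unsign k] gives the fair-coin hypothesis of [walk_sum_stays]. *)
Lemma sum_reflect {R : realType} d (S : {set step d}) (w : step d -> R) k
    (Q : pred (step d)) :
  symmetric_axis S w k -> (forall s, Q (reflect_step k s) = Q s) ->
  \sum_(s | Q s && (step_coord k s == 0%N)) step_weight S w s =
  \sum_(s | Q s && (step_coord k s == 2)) step_weight S w s.
Proof.
move=> sym QE; rewrite (reindex_inj (inv_inj (@reflect_stepK d k))) /=.
apply: eq_big => s; last by rewrite step_weight_reflect.
rewrite QE step_coord_reflect; have := step_coord_le2 k s.
by case: (step_coord k s) => [|[|[|]]].
Qed.

Lemma coord_weight_forward {R : realType} d (S : {set step d})
    (w : step d -> R) k :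
  coord_weight S w k 1 = \sum_(s | step_coord k s == 2) step_weight S w s.
Proof.
rewrite /coord_weight big_mkcondl; apply: eq_bigl => s.
by rewrite /stepc /step_coord; lia.
Qed.

Lemma coord_weight_backward {R : realType} d (S : {set step d})
    (w : step d -> R) k :
  coord_weight S w k (-1) = \sum_(s | step_coord k s == 0%N) step_weight S w s.
Proof.
rewrite /coord_weight big_mkcondl; apply: eq_bigl => s.
by rewrite /stepc /step_coord; lia.
Qed.

(* The first [r] orthant constraints are replaced by their probabilities
   conditionally on the number of moves in each coordinate. *)
Definition mixed_stay {R : realType} {d : nat} (r : nat) (s : seq (step d)) : R :=
  \prod_(j < d) (if (j < r)%N then stay_prob R (moves (step_coord j) s) 1
                 else (stays (step_coord j) 1 s)%:R).

Lemma step_coord_unsign {d : nat} (j k : 'I_d) (s : step d) :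
  j != k -> step_coord j (unsign k s) = step_coord j s.
Proof. by move=> jk; rewrite /step_coord ffunE (negbTE jk). Qed.

(** All factors but the [k]-th depend only on coordinates untouched by [unsign k], so they can play
    the role of [G] in [walk_sum_stays]. *)
Lemma walk_sum_mixed_stayS {R : realType} d (p : step d -> R) (k : 'I_d) n :
  (forall x, \sum_(s | (unsign k s == x) && (step_coord k s == 0%N)) p s =
             \sum_(s | (unsign k s == x) && (step_coord k s == 2)) p s) ->
  walk_sum p n (mixed_stay k) = walk_sum p n (mixed_stay k.+1).
Proof.
move=> psym.
pose G (s : seq (step d)) : R := \prod_(j < d | j != k)
  (if (j < k)%N then stay_prob R (moves (step_coord j) s) 1
   else (stays (step_coord j) 1 s)%:R).
have GE s : G (map (unsign k) s) = G s.
  apply: eq_bigr => j jk.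
  by rewrite (stays_map _ (step_coord j)) ?(moves_map _ (step_coord j))// => t;
     rewrite step_coord_unsign.
have -> : walk_sum p n (mixed_stay k) =
    walk_sum p n (fun s => G (map (unsign k) s) * (stays (step_coord k) 1 s)%:R).
  apply: eq_walk_sum => s; rewrite GE /mixed_stay (bigD1 k)//= ltnn.
  by rewrite mulrC.
rewrite (walk_sum_stays _ _ _ (step_coord_le2 k) psym).
apply: eq_walk_sum => s; rewrite GE /mixed_stay (bigD1 k)//= ltnSn.
rewrite mulrC; congr (_ * _); apply: eq_bigr => j jk.
by rewrite ltnS [in RHS]leq_eqVlt (negbTE jk : (val j == val k) = false).
Qed.

Lemma walk_sum_mixed_stay {R : realType} d (p : step d -> R) r n :
  (r <= d)%N ->
  (forall k : 'I_d, (k < r)%N -> forall x,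
     \sum_(s | (unsign k s == x) && (step_coord k s == 0%N)) p s =
     \sum_(s | (unsign k s == x) && (step_coord k s == 2)) p s) ->
  walk_sum p n (fun s => \prod_(j < d) (stays (step_coord j) 1 s)%:R) =
  walk_sum p n (mixed_stay r).
Proof.
elim: r => [|r IH] rd psym; first by apply: eq_walk_sum => s; apply: eq_bigr.
rewrite IH ?(ltnW rd)//; last by move=> k kr; apply: psym; apply: ltnW.
exact: (walk_sum_mixed_stayS _ _ (Ordinal rd) _ (psym (Ordinal rd) (ltnSn r))).
Qed.

(** * The limit in all coordinates *)

Lemma powR_half {R : realType} (x : R) d : 0 <= x ->
  x `^ (d%:R / 2) = Num.sqrt x ^+ d.
Proof.
by move=> x0; rewrite mulrC powRrM powR12_sqrt// powR_mulrn// sqrtr_ge0.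
Qed.

Lemma sqrtr_prod {R : realType} (I : Type) (s : seq I) (P : pred I) (F : I -> R) :
  (forall i, 0 <= F i) ->
  Num.sqrt (\prod_(i <- s | P i) F i) = \prod_(i <- s | P i) Num.sqrt (F i).
Proof.
move=> F0; elim: s => [|i s IH]; first by rewrite !big_nil sqrtr1.
by rewrite !big_cons; case: (P i); rewrite // sqrtrM// IH.
Qed.

Lemma cvg_walk_sum_orthant {R : realType} d (p : step d.+1 -> R)
    (a : 'I_d.+1 -> R) :
  (forall s, 0 <= p s) -> \sum_s p s = 1 ->
  (forall k, a k = \sum_(s | step_coord k s != 1%N) p s) ->
  (forall k, 0 < a k) ->
  (forall k : 'I_d.+1, (k < d)%N -> forall x,
     \sum_(s | (unsign k s == x) && (step_coord k s == 0%N)) p s =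
     \sum_(s | (unsign k s == x) && (step_coord k s == 2)) p s) ->
  \sum_(s | step_coord ord_max s == 0%N) p s =
  \sum_(s | step_coord ord_max s == 2) p s ->
  (fun n : nat => Num.sqrt (n%:R : R) ^+ d.+1 *
     walk_sum p n (fun s => \prod_(j < d.+1) (stays (step_coord j) 1 s)%:R)) @ \oo
  --> \prod_k Num.sqrt (2 / (pi * a k)).
Proof.
move=> p0 p1 aE a0 psym plast.
pose last s : R := (stays (@step_coord d.+1 ord_max) 1 s)%:R.
pose q (j : 'I_d.+1) s : R := stay_prob R (moves (step_coord j) s) 1.
pose k (j : 'I_d.+1) : R := Num.sqrt (2 / (pi * a j)).
have q01 j s : 0 <= q j s <= 1 by rewrite stay_prob_ge0 stay_prob_le1.
(* The last coordinate keeps its indicator and comes first; the probabilities of the other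
   coordinates are then multiplied in one at a time. *)
pose Y r s := last s * \prod_(j < d.+1 | (j < r)%N) q j s.
have Y01 r s : 0 <= Y r s <= 1.
  have /andP[h0 h1] : 0 <= \prod_(j < d.+1 | (j < r)%N) q j s <= 1.
    apply/andP; split; first by apply: prodr_ge0 => j _; case/andP: (q01 j s).
    by apply: prodr_ile1 => j _; apply: q01.
  rewrite /Y /last; case: (stays _ _ _); rewrite ?mul1r ?mul0r ?lexx ?ler01//.
  by rewrite h0.
have lastcvg : (fun n : nat => Num.sqrt (n%:R : R) ^+ 1 * walk_sum p n last) @ \oo
    --> k ord_max.
  have one : (fun n : nat => Num.sqrt (n%:R : R) ^+ 0 *
      walk_sum p n (fun _ => 1)) @ \oo --> (1 : R).
    have -> : (fun n : nat => Num.sqrt (n%:R : R) ^+ 0 *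
      walk_sum p n (fun _ => 1)) = cst 1.
      apply/funext => n; rewrite expr0 mul1r /cst.
      by elim: n => //= n IH; under eq_bigr do rewrite IH mulr1.
    exact: cvg_cst.
  have b01 (s : seq (step d.+1)) : 0 <= (1 : R) <= 1 by rewrite ler01 lexx.
  have := cvg_walk_sum_stay_prob p (step_coord ord_max) (a ord_max) _ 0 1
    p0 p1 (aE _) (a0 _) b01 one.
  rewrite mulr1 -/(k ord_max).
  set f := (X in X @ _ --> _) => fc; set g := (X in X @ _ --> _).
  have -> // : g = f.
  apply/funext => n; rewrite /g /f; congr *%R.
  (* A constant [kappa] conditions on nothing, so balance of the marginal weights is enough for the
     last coordinate on its own. *)
  have csym (x : unit) :
      \sum_(s | (tt == x) && (step_coord ord_max s == 0%N)) p s =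
      \sum_(s | (tt == x) && (step_coord ord_max s == 2)) p s.
    by case: x => /=.
  have := walk_sum_stays p (step_coord ord_max) (fun _ => tt)
    (step_coord_le2 _) csym n 1
    (fun _ => 1) => /= <-.
  by apply: eq_walk_sum => s; rewrite mul1r.
have Ycvg r : (r <= d)%N ->
    (fun n : nat => Num.sqrt (n%:R : R) ^+ r.+1 * walk_sum p n (Y r)) @ \oo
    --> k ord_max * \prod_(j < d.+1 | (j < r)%N) k j.
  elim: r => [|r IH] rd.
    rewrite big_pred0// mulr1.
    have -> : Y 0%N = last; last by [].
    by apply/funext => s; rewrite /Y big_pred0// mulr1.
  have rd1 : (r < d.+1)%N by exact: ltnW.
  pose i := Ordinal rd1.
  have split_prod (F : 'I_d.+1 -> R) : \prod_(j < d.+1 | (j < r.+1)%N) F j =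
      F i * \prod_(j < d.+1 | (j < r)%N) F j.
    rewrite (bigD1 i)//=; congr *%R; apply: eq_bigl => j.
    by rewrite ltnS -val_eqE /= [RHS]ltn_neqAle andbC.
  have := cvg_walk_sum_stay_prob p (step_coord i) (a i) (Y r) r.+1 _
    p0 p1 (aE _) (a0 _) (Y01 r) (IH (ltnW rd)).
  rewrite split_prod mulrCA -/(k i).
  have -> // : Y r.+1 = (fun s => Y r s * stay_prob R (moves (step_coord i) s) 1).
  by apply/funext => s; rewrite /Y split_prod -/(q i s); ring.
have := Ycvg d (leqnn d).
have ordlt (j : 'I_d.+1) : (j < d)%N = (j != ord_max).
  by rewrite -val_eqE /= ltn_neqAle -ltnS ltn_ord andbT.
have -> : k ord_max * \prod_(j < d.+1 | (j < d)%N) k j = \prod_j k j.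
  by rewrite [RHS](bigD1 ord_max)//=; congr *%R; apply: eq_bigl.
set f := (X in X @ _ --> _) => fc; set g := (X in X @ _ --> _).
have -> // : g = f.
apply/funext => n; rewrite /g /f (walk_sum_mixed_stay _ _ d)//.
congr *%R; apply: eq_walk_sum => s; rewrite /Y /mixed_stay (bigD1 ord_max)//=.
rewrite ltnn; congr *%R; apply: eq_big => [j|j]; first by rewrite ordlt.
by move=> jd; rewrite ordlt jd.
Qed.

Theorem mainTheorem1 (R : realType) (d : nat) (S : {set step d})
  (w : step d -> R) :
  (0 < d)%N ->
  zero_step d \notin S ->
  (forall s, s \in S -> 0 < w s) ->
  (forall k : 'I_d, (k < d.-1)%N -> symmetric_axis S w k) ->
  (forall j : 'I_d, (exists2 s, s \in S & stepc s j = 1) /\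
                    (exists2 s, s \in S & stepc s j = -1)) ->
  (forall k : 'I_d, val k = d.-1 ->
     coord_weight S w k (-1) = coord_weight S w k 1) ->
  (fun n : nat =>
     num_walks S w n /
     (total_weight S w ^+ n * (n%:R) `^ (- (d%:R / 2)) *
      (total_weight S w `^ (d%:R / 2) /
       (pi `^ (d%:R / 2) * Num.sqrt (\prod_(k < d) coord_weight S w k 1)))))
  @ \oo --> (1 : R).
Proof.
case: d S w => // d S w _ _ wpos sym moving drift.
set W := total_weight S w; pose b k := coord_weight S w k 1.
have b0 k : 0 < b k.
  have [[s sS sk] _] := moving k.
  rewrite /b /coord_weight (bigD1 s) ?sS ?sk ?eqxx//=.
  rewrite ltr_pwDl ?wpos// sumr_ge0// => t /andP[/andP[tS _] _].
  by rewrite ltW// wpos.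
have W0 : 0 < W.
  have [[s sS sk] _] := moving ord0.
  rewrite /W /total_weight (bigD1 s)//= ltr_pwDl ?wpos// sumr_ge0//.
  by move=> t /andP[tS _]; rewrite ltW// wpos.
have Wn : W != 0 by rewrite gt_eqF.
have sw0 s : 0 <= step_weight S w s.
  by rewrite /step_weight; case: ifP => // sS; rewrite ltW// wpos.
have WE : W = \sum_s step_weight S w s by rewrite /W /total_weight big_mkcond.
pose p s := W^-1 * step_weight S w s.
have p0 s : 0 <= p s by rewrite mulr_ge0// invr_ge0 ltW.
have p1 : \sum_s p s = 1 by rewrite -mulr_sumr -WE mulVf.
(* Reflection settles the symmetric axes, zero drift the last one. *)
have bal k : coord_weight S w k (-1) = b k.
  have [kd|kd] := ltnP k d; last first.
    by apply: drift; apply/eqP; rewrite eqn_leq kd andbT -ltnS ltn_ord.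
  have := sum_reflect d.+1 S w k predT (sym k kd) (fun _ => erefl).
  by rewrite /b coord_weight_forward coord_weight_backward.
pose a k : R := W^-1 * (2 * b k).
have aE k : a k = \sum_(s | step_coord k s != 1%N) p s.
  rewrite -mulr_sumr /a; congr *%R.
  rewrite (bigID (fun s => step_coord k s == 0%N))/= mulr2n mulrDl mul1r.
  rewrite -{1}bal coord_weight_backward /b coord_weight_forward.
  congr +%R; apply: eq_bigl => s; have := step_coord_le2 k s;
    by case: (step_coord k s) => [|[|[|]]].
have a0 k : 0 < a k by rewrite mulr_gt0 ?invr_gt0// mulr_gt0.
have psym (k : 'I_d.+1) : (k < d)%N -> forall x,
     \sum_(s | (unsign k s == x) && (step_coord k s == 0%N)) p s =
     \sum_(s | (unsign k s == x) && (step_coord k s == 2)) p s.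
  move=> kd x; rewrite -!mulr_sumr; congr *%R.
  apply: (sum_reflect d.+1 S w k (fun s => unsign k s == x) (sym k kd)) => s.
  by rewrite unsign_reflect.
have plast : \sum_(s | step_coord ord_max s == 0%N) p s =
    \sum_(s | step_coord ord_max s == 2) p s.
  rewrite -!mulr_sumr; congr *%R.
  by rewrite -coord_weight_backward -coord_weight_forward bal.
have main := cvg_walk_sum_orthant d p a p0 p1 aE a0 psym plast.
set L := \prod_k _ in main.
have pi0 : 0 < pi :> R := pi_gt0 R.
(* Since [a k = 2 * b k / W], each factor of [L] equals [sqrt (W / (pi * b k))]. *)
have LE : L = Num.sqrt W ^+ d.+1 / (Num.sqrt pi ^+ d.+1 *
    Num.sqrt (\prod_k b k)).
  rewrite sqrtr_prod => [|k]; last exact: ltW.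
  have pc (x : R) : x ^+ d.+1 = \prod_(k < d.+1) x.
    by rewrite prodr_const card_ord.
  rewrite !pc -big_split /= -prodf_div.
  apply: eq_bigr => k _; rewrite -sqrtrM ?(ltW pi0)//.
  rewrite -sqrtrV ?mulr_ge0 ?ltW// -sqrtrM ?ltW//; congr Num.sqrt.
  rewrite /a; move: (@pi R) pi0 => x x0.
  by field; rewrite Wn !gt_eqF.
have L0 : L != 0.
  rewrite gt_eqF// prodr_gt0// => k _.
  by rewrite sqrtr_gt0 divr_gt0// mulr_gt0.
pose g n : R := Num.sqrt (n%:R : R) ^+ d.+1 *
  walk_sum p n (fun s => \prod_(j < d.+1) (stays (step_coord j) 1 s)%:R) / L.
have gcvg : g @ \oo --> (1 : R).
  have -> : (1 : R) = L * L^-1 by rewrite divff.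
  by apply: cvgM; [exact: main|exact: cvg_cst].
set f := (X in X @ _ --> _).
suff fg : \forall n \near \oo, g n = f n.
  exact: (cvg_trans (near_eq_cvg fg) gcvg).
(* At [n = 0] the factor [sqrt n] vanishes and could not be cancelled. *)
exists 1%N => // n /= n0.
rewrite /f /g powRN !powR_half ?(ltW W0) ?(ltW pi0)// -LE.
rewrite num_walks_walk_sum.
have -> : walk_sum (step_weight S w) n
    (fun s => \prod_(j < d.+1) (stays (step_coord j) 1 s)%:R) =
  W ^+ n * walk_sum p n (fun s => \prod_(j < d.+1) (stays (step_coord j) 1 s)%:R).
  rewrite /p walk_sum_scale exprVn mulrA divff ?mul1r// expf_neq0//.
have sn : Num.sqrt (n%:R : R) ^+ d.+1 != 0.
  by rewrite expf_neq0// gt_eqF// sqrtr_gt0 ltr0n.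
have WW : W ^+ n != 0 by rewrite expf_neq0.
by field; rewrite L0 WW sn.
Qed.
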